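(* Let $\kappa\ge1$, $n\ge1$ be integers and $0<\epsilon<1$. Let $\bar q\in\mathbb{R}^{2^\kappa}$ be the uniform vector fraction code: $\bar q_0=0$ and $\bar q_i=\frac{1}{2^\kappa-1}$ for $1\le i\le 2^\kappa-1$. Then $\bar q$ is a local minimizer of $q\mapsto l(n,\epsilon,q)$ on $\mathcal{C}=\{q\in\mathbb{R}^{2^\kappa}: q_i\ge0\ \forall i,\ \sum_i q_i=1\}$.
   Context: $W=\mathbb{F}_2^\kappa$; $\nu(i)\in W$ is the binary expansion of $i\in\{0,\dots,2^\kappa-1\}$; vectors $q\in\mathbb{R}^{2^\kappa}$ are indexed $q_0,\dots,q_{2^\kappa-1}$. For a subspace $S\subseteq W$, $\zeta(S,q)=\sum_{i:\nu(i)\in S}q_i$; $\Xi(W,d)$ is the set of $d$-dimensional subspaces of $W$. For real $q$, the (continuous) expected equivocation loss is $l(n,\epsilon,q)=n(1-\epsilon)-\kappa+\sum_{\delta=1}^{\kappa}K_\delta\sum_{S\in\Xi(W,\kappa-\delta)}\epsilon^{n(1-\zeta(S,q))}$, with $K_\delta=\prod_{i=1}^{\delta-1}(1-2^i)$. (When $q_i$ is the fraction of columns of a $\kappa\times n$ generator matrix equal to $\nu(i)$, this is the expected equivocation loss of the coset code over a binary erasure channel with erasure probability $\epsilon$.) A local minimizer of $f$ on a set $\mathcal{C}$ is a point $q\in\mathcal{C}$ with $f(q)\le f(q')$ for all $q'\in\mathcal{C}$ in some neighborhood of $q$. *)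

(* Defs.v *)
From mathcomp Require Import all_boot all_order all_algebra.
From mathcomp Require Import all_classical all_reals all_analysis.
Set Implicit Arguments. Unset Strict Implicit. Unset Printing Implicit Defensive.
Import Order.TTheory GRing.Theory Num.Theory.
Local Open Scope ring_scope.

Notation W kappa := ('rV['F_2]_kappa).

Definition nu (kappa : nat) (i : 'I_(2 ^ kappa)) : W kappa :=
  \row_(j < kappa) ((odd (i %/ 2 ^ j))%:R : 'F_2).

Definition is_subspace (kappa : nat) (S : {set W kappa}) : bool :=
  (0 \in S) &&
  [forall a : 'F_2, forall u : W kappa, forall v : W kappa,
     (u \in S) ==> (v \in S) ==> (a *: u + v \in S)].

Definition Xi (kappa d : nat) : {set {set W kappa}} :=
  [set S : {set W kappa} | is_subspace S && (\dim <<enum S>>%VS == d)].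

Definition zeta (R : realType) (kappa : nat) (S : {set W kappa})
    (q : 'I_(2 ^ kappa) -> R) : R :=
  \sum_(i < 2 ^ kappa | nu i \in S) q i.

Definition Kc (R : realType) (delta : nat) : R :=
  \prod_(1 <= i < delta) (1 - 2 ^+ i).

Definition loss (R : realType) (kappa n : nat) (eps : R)
    (q : 'I_(2 ^ kappa) -> R) : R :=
  n%:R * (1 - eps) - kappa%:R +
  \sum_(1 <= delta < kappa.+1)
     Kc R delta * \sum_(S in Xi kappa (kappa - delta))
        eps `^ (n%:R * (1 - zeta S q)).

Definition simplexC (R : realType) (kappa : nat) (q : 'I_(2 ^ kappa) -> R) : Prop :=
  (forall i, 0 <= q i) /\ \sum_(i < 2 ^ kappa) q i = 1.

Definition local_minimizer (R : realType) (kappa : nat)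
    (C : ('I_(2 ^ kappa) -> R) -> Prop) (f : ('I_(2 ^ kappa) -> R) -> R)
    (q : 'I_(2 ^ kappa) -> R) : Prop :=
  C q /\ exists delta : R, 0 < delta /\
    forall q', C q' -> (forall i, `|q' i - q i| < delta) -> f q <= f q'.

Definition qbar (R : realType) (kappa : nat) (i : 'I_(2 ^ kappa)) : R :=
  if val i == 0%N then 0 else (2 ^+ kappa - 1)^-1.

(* Main.v *)
Require Import Defs.
From mathcomp Require Import all_boot all_order all_algebra.
From mathcomp Require Import all_classical all_reals all_analysis.
From mathcomp Require Import finfield ring zify.
Set Implicit Arguments.
Unset Strict Implicit.
Unset Printing Implicit Defensive.
Import Order.TTheory GRing.Theory Num.Theory.
Local Open Scope ring_scope.

(* Put y_v = - n ln(eps) q_v >= 0 and reveal each v in W independently with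
   probability 1 - exp(-y_v).  On the simplex eps^(n (1 - zeta(S, q))) is then
   the probability that the revealed set A lies in S, and since
     sum over T <= S < W of K_(codim S) = codim T,
   the sum in the loss is the expected codimension of the span of A.
   Differentiating twice in a direction h replaces the weight K_(codim S) by
   K_(codim S) (sum of h_v for v not in S)^2, and the sum of these weights over
   S >= T is the sum of the squares (sum of h_v for v in C)^2, where C ranges
   over the cosets of T other than T.  Hence the loss is convex on the simplex.
   At the uniform code the partial derivatives agree for all nonzero v, because
   a transvection swaps any two nonzero vectors, and the derivative at v = 0 is
   no smaller; so the uniform code is even a global minimizer. *)

(** * Subspaces over the two-element field: dimension, adjunction of a vector, hyperplanes *)

Section Subspaces.

Variable k : nat.
Implicit Types (S T H A : {set W k}) (u v w : W k).

Lemma addrr_F2 u : u + u = 0.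
Proof. by apply/rowP => j; rewrite !mxE addrr_pchar2 ?pchar_Fp. Qed.

Lemma addKv u : cancel (+%R u) (+%R u).
Proof. by move=> v; rewrite addrA addrr_F2 add0r. Qed.

Lemma subspace0 S : is_subspace S -> 0 \in S.
Proof. by case/andP. Qed.

Lemma subspaceD S u v : is_subspace S -> u \in S -> v \in S -> u + v \in S.
Proof.
case/andP=> _ /forallP/(_ 1)/forallP/(_ u)/forallP/(_ v).
by rewrite scale1r => /implyP + uS vS => /(_ uS)/implyP ->.
Qed.

Lemma subspace_intro S :
  0 \in S -> {in S &, forall u v, u + v \in S} -> is_subspace S.
Proof.
move=> S0 SD; apply/andP; split=> //.
apply/forallP=> a; apply/forallP=> u; apply/forallP=> v.
apply/implyP=> uS; apply/implyP=> vS.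
have [->|->] : a = 0 \/ a = 1.
- by case: a => [[|[|//]] ?]; [left|right]; apply/val_inj.
- by rewrite scale0r add0r.
- by rewrite scale1r SD.
Qed.

Lemma subspaceDl S u v : is_subspace S -> u \in S -> (u + v \in S) = (v \in S).
Proof.
move=> subS uS; apply/idP/idP => [uvS|]; last exact: subspaceD.
by rewrite -(addKv u v) subspaceD.
Qed.

Lemma subspaceT : is_subspace [set: W k].
Proof. by apply: subspace_intro => [|u v _ _]; rewrite inE. Qed.

Lemma subspaceI S T : is_subspace S -> is_subspace T -> is_subspace (S :&: T).
Proof.
move=> subS subT; apply: subspace_intro; first by rewrite inE !subspace0.
by move=> u v /setIP[uS uT] /setIP[vS vT]; rewrite inE !subspaceD.
Qed.

Definition sdim S := \dim <<enum S>>%VS.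

Lemma mem_span_enum S : is_subspace S -> <<enum S>>%VS =i S.
Proof.
move=> subS u; apply/idP/idP => [uS|uS]; last by rewrite memv_span ?mem_enum.
rewrite (@coord_span _ _ _ (in_tuple (enum S)) u uS).
apply: (big_ind (fun v => v \in S)) => [|v w vS wS|i _].
- exact: subspace0.
- exact: subspaceD.
- rewrite -[X in X \in _]addr0.
  case/andP: (subS) => S0 /forallP/(_ (coord (in_tuple (enum S)) i u)).
  move=> /forallP/(_ (in_tuple (enum S))`_i)/forallP/(_ 0)/implyP + .
  by rewrite S0 -mem_enum mem_nth //; apply.
Qed.

Lemma card_subspace S : is_subspace S -> #|S| = (2 ^ sdim S)%N.
Proof.
move=> subS; rewrite -(eq_card (mem_span_enum subS)).
by rewrite (@card_vspace _ 'rV_k) card_Fp.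
Qed.

Lemma sdimT : sdim [set: W k] = k.
Proof.
apply/eqP; rewrite -(@eqn_exp2l 2) // -card_subspace ?subspaceT //.
by rewrite cardsT card_mx card_Fp // mul1n.
Qed.

Lemma sdim_le S T : is_subspace S -> is_subspace T -> S \subset T ->
  (sdim S <= sdim T)%N.
Proof.
by move=> subS subT /subset_leq_card; rewrite !card_subspace // leq_exp2l.
Qed.

Lemma sdim_lt S T : is_subspace S -> is_subspace T -> S \proper T ->
  (sdim S < sdim T)%N.
Proof.
by move=> subS subT /proper_card; rewrite !card_subspace // ltn_exp2l.
Qed.

(** For a subspace [S] this is the span of [S] and [w]: the only scalars are 0 and 1, so it is the
    union of [S] and its translate by [w]. *)
Definition adjoin S w : {set W k} := [set u | (u \in S) || (w + u \in S)].

Lemma subset_adjoin S w : S \subset adjoin S w.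
Proof. by apply/fintype.subsetP => u uS; rewrite inE uS. Qed.

Lemma mem_adjoin S w : is_subspace S -> w \in adjoin S w.
Proof. by move=> subS; rewrite inE addrr_F2 subspace0 ?orbT. Qed.

Lemma subspace_adjoin S w : is_subspace S -> is_subspace (adjoin S w).
Proof.
move=> subS; apply: subspace_intro; first by rewrite inE subspace0.
move=> u v; rewrite !inE => /orP[uS|uS] /orP[vS|vS].
- by rewrite (subspaceD subS uS vS).
- by rewrite addrCA (subspaceD subS uS vS) ?orbT.
- by rewrite addrA (subspaceD subS uS vS) ?orbT.
- have -> : u + v = (w + u) + (w + v) by rewrite addrACA addrr_F2 add0r.
  by rewrite (subspaceD subS uS vS).
Qed.

Lemma adjoin_subset S T w : is_subspace T -> S \subset T -> w \in T ->
  adjoin S w \subset T.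
Proof.
move=> subT /fintype.subsetP ST wT; apply/fintype.subsetP => u.
by rewrite inE => /orP[/ST//|/ST]; rewrite subspaceDl.
Qed.

Lemma card_adjoin S w : is_subspace S -> w \notin S ->
  #|adjoin S w| = (2 * #|S|)%N.
Proof.
move=> subS wS.
have -> : adjoin S w = S :|: [set w + u | u in S].
  apply/setP => u; rewrite !inE; congr (_ || _).
  apply/idP/imsetP => [wuS|[v vS ->]]; last by rewrite addKv.
  by exists (w + u); rewrite ?addKv.
rewrite cardsU (_ : _ :&: _ = finset.set0) ?cards0 ?subn0.
  by rewrite card_imset ?mul2n ?addnn //; apply: can_inj (addKv w).
apply/setP => u; rewrite !inE; apply/negP => /andP[uS /imsetP[v vS uE]].
by move: uS; rewrite uE addrC subspaceDl // (negPf wS).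
Qed.

Lemma sdim_adjoin S w : is_subspace S -> w \notin S ->
  sdim (adjoin S w) = (sdim S).+1.
Proof.
move=> subS wS; apply/eqP; rewrite -(@eqn_exp2l 2) //.
by rewrite expnS -!card_subspace ?subspace_adjoin // card_adjoin.
Qed.

(** A maximal proper subspace of [H] above [T] works; the last clause expresses that it has
    codimension one in [H]. *)
Lemma hyperplane_exists T H : is_subspace T -> is_subspace H -> T \proper H ->
  exists H', [/\ is_subspace H', T \subset H', H' \proper H &
    {in H :\: H', forall w, adjoin H' w = H}].
Proof.
move=> subT subH TH.
have := @maxset_exists _ (fun S => is_subspace S && (S \proper H)) T.
rewrite subT TH => /(_ isT)[H' /maxsetP[/andP[subH' H'H] maxH'] TH'].
exists H'; split=> // w; rewrite inE => /andP[wH' wH].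
have sub_adj : adjoin H' w \subset H by rewrite adjoin_subset // proper_sub.
apply/eqP; rewrite eqEproper sub_adj; apply: contra wH' => adjH.
have <- := maxH' (adjoin H' w); rewrite ?mem_adjoin ?subset_adjoin //.
by rewrite subspace_adjoin.
Qed.

(** Together with [setI_adjoin]: for a fixed [w] in [H] outside a hyperplane [H'] of [H],
    intersecting with [H'] and adjoining [w] are inverse bijections between the subspaces of [H]
    through [w] and the subspaces of [H']. *)
Lemma adjoin_setI S H H' w : is_subspace S -> S \subset H -> is_subspace H' ->
  w \in S -> adjoin H' w = H -> adjoin (S :&: H') w = S.
Proof.
move=> subS /fintype.subsetP SH subH' wS adjH.
apply/setP => u; rewrite !inE subspaceDl // -andb_orr.
by apply/andP/idP => [[]//|uS]; move: (SH _ uS); rewrite -adjH inE.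
Qed.

Lemma setI_adjoin S H w : is_subspace H -> S \subset H -> w \notin H ->
  adjoin S w :&: H = S.
Proof.
move=> subH /fintype.subsetP SH wH; apply/setP => u; rewrite !inE.
apply/andP/idP => [[/orP[//|/SH wuH] uH]|uS]; last by rewrite uS SH.
by move: wuH; rewrite addrC subspaceDl // (negPf wH).
Qed.

End Subspaces.

(** * Sums of the constants K over intervals of subspaces *)

Section Weights.

Variables (R : realType) (k : nat).
Implicit Types (S T H A : {set W k}) (u v w : W k).

Lemma KcS d : (0 < d)%N -> Kc R d.+1 = Kc R d * (1 - 2 ^+ d).
Proof. by move=> d0; rewrite /Kc big_nat_recr. Qed.

Lemma Kc1 : Kc R 1 = 1.
Proof. by rewrite /Kc big_geq. Qed.

(** Double counting of pairs ([S], [w]) with [w] in [S :\: H']. A subspace S' properly inside [H']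
    is the trace of |H'| / |S'| subspaces [S], and the codimension of each [S] in [H] equals that of
    S' in [H']. *)
Lemma sum_Kc_off_hyperplane T H H' :
  is_subspace T -> is_subspace H -> is_subspace H' ->
  T \subset H' -> H' \proper H -> {in H :\: H', forall w, adjoin H' w = H} ->
  \sum_(S | [&& is_subspace S, T \subset S, S \proper H & ~~ (S \subset H')])
     Kc R (sdim H - sdim S) =
  \sum_(S | [&& is_subspace S, T \subset S & S \proper H'])
     2 ^+ (sdim H' - sdim S) * Kc R (sdim H' - sdim S).
Proof.
move=> subT subH subH' TH' H'H adjH.
have TH := fintype.subset_trans TH' (proper_sub H'H).
have [_ [w0 w0H w0H']] := fintype.properP H'H.
have adj0 : adjoin H' w0 = H by rewrite adjH // inE w0H'.
have cardHH' : #|H :\: H'| = #|H'|.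
  rewrite cardsD (finset.setIidPr (proper_sub H'H)) -adj0 card_adjoin //.
  by rewrite mul2n -addnn addnK.
have dimH : sdim H = (sdim H').+1 by rewrite -adj0 sdim_adjoin.
(* The weight of [S] is shared equally among the vectors of [S :\: H'], which are as many as those
   of [S :&: H']. *)
pose g S : R := Kc R (sdim H - sdim S) / #|S :&: H'|%:R.
transitivity (\sum_(S | [&& is_subspace S, T \subset S, S \proper H &
      ~~ (S \subset H')]) \sum_(w in S :\: H') g S).
  apply: eq_bigr => S /and4P[subS TS SH SH'].
  have [w wS wH'] := fintype.subsetPn SH'.
  have adjS : adjoin (S :&: H') w = S.
    apply: (@adjoin_setI _ S H) => //; first exact: proper_sub.
    by rewrite adjH // inE wH' (fintype.subsetP (proper_sub SH)).
  have subI := subspaceI subS subH'.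
  have cardS : #|S :\: H'| = #|S :&: H'|.
    rewrite cardsD -{1}adjS card_adjoin ?inE ?negb_and ?wH' ?orbT //.
    by rewrite mul2n -addnn addnK.
  rewrite sumr_const cardS -[RHS]mulr_natr /g divfK //.
  by rewrite pnatr_eq0 card_subspace // -lt0n expn_gt0.
rewrite (exchange_big_dep (mem (H :\: H'))) /=; last first.
  move=> S w /and4P[_ _ SH _]; rewrite !inE => /andP[-> /=].
  exact: (fintype.subsetP (proper_sub SH)).
transitivity (\sum_(w in H :\: H')
    \sum_(S | [&& is_subspace S, T \subset S & S \proper H'])
     Kc R (sdim H' - sdim S) / #|S|%:R); last first.
  rewrite sumr_const cardHH' -[LHS]mulr_natl mulr_sumr; apply: eq_bigr => S.
  case/and3P => subS TS SH'; rewrite mulrA [LHS]mulrAC; congr (_ * _).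
  rewrite !card_subspace // !natrX -[in LHS](subnK (sdim_le subS subH' (proper_sub SH'))).
  by rewrite exprD mulfK // expf_neq0 // pnatr_eq0.
apply: eq_bigr => w wHH'; have := wHH'; rewrite inE => /andP[wH' wH].
(* For fixed [w], the subspaces [S] through [w] are parametrized by their traces on [H']. *)
rewrite (reindex_onto (fun S => adjoin S w) (fun S => S :&: H')) /=; last first.
  move=> S /andP[/and4P[subS TS SH SH']]; rewrite inE => /andP[_ wS].
  by apply: (@adjoin_setI _ S H) => //; [apply: proper_sub | apply: adjH].
have key S : [&& is_subspace S, T \subset S & S \proper H'] ->
    adjoin S w :&: H' = S.
  by case/and3P=> _ _ /proper_sub SH'; apply: setI_adjoin.
have predE S : [&& is_subspace (adjoin S w), T \subset adjoin S w,
      adjoin S w \proper H & ~~ (adjoin S w \subset H')] &&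
      (w \in adjoin S w :\: H') && (adjoin S w :&: H' == S) =
    [&& is_subspace S, T \subset S & S \proper H'].
  apply/idP/idP => [/andP[/andP[/and4P[subA TA AH AH'] _] /eqP SE]|PS].
    have subS : is_subspace S by rewrite -SE subspaceI.
    have TS : T \subset S by rewrite -SE finset.subsetI TA.
    have SH' : S \subset H' by rewrite -SE finset.subsetIr.
    rewrite subS TS finset.properEneq SH' andbT /=.
    by apply: contraTN AH => /eqP ->; rewrite adjH // fintype.properxx.
  have SE := key S PS; case/and3P: PS => subS TS SH'.
  have subA := subspace_adjoin w subS.
  rewrite SE eqxx subA (fintype.subset_trans TS (subset_adjoin _ _)) inE wH' mem_adjoin //.
  rewrite finset.properEneq adjoin_subset ?(fintype.subset_trans (proper_sub SH') (proper_sub H'H)) //.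
  rewrite !andbT /=; apply/andP; split.
    apply: contraTneq SH' => AE; rewrite -SE AE (finset.setIidPr (proper_sub H'H)).
    by rewrite fintype.properxx.
  by apply/fintype.subsetPn; exists w; rewrite ?mem_adjoin.
apply: eq_big => // S; rewrite predE => PS; rewrite /g key //.
case/and3P: PS => subS TS /proper_sub/fintype.subsetP SH'.
by rewrite sdim_adjoin ?dimH ?subSS //; apply: contra wH' => /SH'.
Qed.

(** Induction on the dimension of [H] through a hyperplane [H']. A subspace of codimension d > 0 in
    [H'] contributes K_(d+1) = K_d (1 - 2^d), the subspaces off [H'] with that trace contribute 2^d
    K_d, together K_d; [H'] itself adds K_1 = 1. *)
Lemma sum_Kc_interval T H : is_subspace T -> is_subspace H -> T \subset H ->
  \sum_(S | [&& is_subspace S, T \subset S & S \proper H])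
     Kc R (sdim H - sdim S) = (sdim H - sdim T)%:R.
Proof.
move: {2}(sdim H) (leqnn (sdim H)) => m.
elim: m H => [|m IHm] H dimHm subT subH.
all: rewrite subEproper => /predU1P[<-|TH].
1,3: rewrite subnn big_pred0 // => S; apply/and3P => -[_ TS ST].
1,2: by have := sub_proper_trans TS ST; rewrite fintype.properxx.
  by have := leq_trans (sdim_lt subT subH TH) dimHm.
have [H' [subH' TH' H'H adjH]] := hyperplane_exists subT subH TH.
have [_ [w0 w0H w0H']] := fintype.properP H'H.
have adj0 : adjoin H' w0 = H by rewrite adjH // inE w0H'.
have dimH : sdim H = (sdim H').+1 by rewrite -adj0 sdim_adjoin.
rewrite (bigID (fun S => S \subset H')) /=.
rewrite [X in _ + X](eq_bigl (fun S => [&& is_subspace S, T \subset S,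
  S \proper H & ~~ (S \subset H')])) => [|S]; last by rewrite -!andbA.
rewrite (sum_Kc_off_hyperplane subT subH) // (bigD1 H') /=; last first.
  by rewrite subH' TH' H'H fintype.subxx.
rewrite dimH subSn ?leqnn // subnn Kc1.
rewrite (eq_bigl (fun S => [&& is_subspace S, T \subset S & S \proper H'])); last first.
  move=> S /=; apply/idP/idP.
    case/andP=> /andP[/and3P[-> -> _] SH'] SneqH'.
    by rewrite finset.properEneq SH' SneqH'.
  case/and3P=> -> -> SH'; rewrite (proper_sub SH').
  rewrite (fintype.proper_trans SH' H'H) /=.
  by move: SH'; rewrite finset.properEneq => /andP[].
rewrite -addrA -big_split /= (eq_bigr (fun S => Kc R (sdim H' - sdim S))).
  rewrite IHm ?subSn ?sdim_le ?natr1 1?addrC ?natr1 //.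
  by rewrite -ltnS -dimH.
move=> S /and3P[subS TS SH']; have lt := sdim_lt subS subH' SH'.
rewrite subSn ?(ltnW lt) // KcS ?subn_gt0 //.
by rewrite mulrBr mulr1 [X in _ - X]mulrC subrK.
Qed.

End Weights.

(** * Weighted sums over the proper subspaces, revealed sets, symmetry under transvections *)

Section Codimension.

Variables (R : realType) (k : nat).
Implicit Types (S T A : {set W k}) (u v w : W k).

Definition proper_subspace S := is_subspace S && (S \proper [set: W k]).

Definition codimK S : R := Kc R (k - sdim S).

Lemma sum_codimK T : is_subspace T ->
  \sum_(S | proper_subspace S && (T \subset S)) codimK S = (k - sdim T)%:R.
Proof.
move=> subT.
have := sum_Kc_interval R subT (subspaceT k) (finset.subsetT T).
rewrite sdimT => <-.
apply: eq_big => [S|//].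
by rewrite /proper_subspace -andbA; congr andb; rewrite andbC.
Qed.

Lemma sum_mem_adjoin (f : {set W k} -> R) T u : is_subspace T ->
  \sum_(S | proper_subspace S && (T \subset S)) f S * (u \in S)%:R =
  \sum_(S | proper_subspace S && (adjoin T u \subset S)) f S.
Proof.
move=> subT.
rewrite [RHS](eq_bigl (fun S => (proper_subspace S && (T \subset S)) && (u \in S))) => [|S].
  by rewrite [RHS]big_mkcondr; apply: eq_bigr => S _; case: ifP; rewrite ?mulr1 ?mulr0.
rewrite -andbA; case: (boolP (proper_subspace S)) => //= /andP[subS _].
apply/idP/andP => [TS|[TS uS]]; last exact: adjoin_subset.
split; first exact: fintype.subset_trans (subset_adjoin _ _) TS.
exact: (fintype.subsetP TS) (mem_adjoin _ subT).
Qed.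

Lemma adjoin_id T u : is_subspace T -> u \in T -> adjoin T u = T.
Proof. by move=> subT uT; apply/setP => v; rewrite inE subspaceDl // orbb. Qed.

Lemma natr_negb (b : bool) : (~~ b)%:R = 1 - b%:R :> R.
Proof. by case: b; rewrite /= ?subrr ?subr0. Qed.

(** The sum is the codimension of [T] minus that of [adjoin T u], which differ by one exactly when
    [u] is outside [T]. *)
Lemma sum_codimK_notin T u : is_subspace T ->
  \sum_(S | proper_subspace S && (T \subset S)) codimK S * (u \notin S)%:R =
  (u \notin T)%:R.
Proof.
move=> subT.
under eq_bigr => S _ do rewrite (natr_negb (u \in S)) mulrBr mulr1.
rewrite sumrB sum_mem_adjoin // !sum_codimK ?subspace_adjoin //.
case: (boolP (u \in T)) => uT; first by rewrite adjoin_id // subrr.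
have := sdim_le (subspace_adjoin u subT) (subspaceT k) (finset.subsetT _).
rewrite sdimT sdim_adjoin // => ltk; rewrite subnS -natrB ?leq_pred //.
by congr (_%:R); lia.
Qed.

(** Difference of [sum_codimK_notin] at [T] and at [adjoin T v]; it detects whether [u] and [v]
    share a coset of [T] other than [T]. *)
Lemma sum_codimK_notin2 T u v : is_subspace T ->
  \sum_(S | proper_subspace S && (T \subset S))
     codimK S * (u \notin S)%:R * (v \notin S)%:R =
  ((u \notin T) && (v + u \in T))%:R.
Proof.
move=> subT.
under eq_bigr => S _ do rewrite (natr_negb (v \in S)) mulrBr mulr1.
rewrite sumrB sum_mem_adjoin // !sum_codimK_notin ?subspace_adjoin // inE.
by case: (u \in T); case: (v + u \in T); rewrite /= ?subrr ?subr0.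
Qed.

(* The form is a sum of squares over the cosets of T other than T itself. *)
Lemma coset_form_ge0 T (h : W k -> R) : is_subspace T ->
  0 <= \sum_u \sum_v h u * h v * ((u \notin T) && (v + u \in T))%:R.
Proof.
move=> subT.
have cardT : (0 < #|T|%:R :> R) by rewrite ltr0n card_subspace // expn_gt0.
(* The squares below are indexed by vectors [z] rather than by cosets, so each coset is counted |T|
   times. *)
rewrite -(pmulr_rge0 _ cardT).
suff -> : #|T|%:R * \sum_u \sum_v h u * h v * ((u \notin T) && (v + u \in T))%:R =
    \sum_(z | z \notin T) (\sum_(v | z + v \in T) h v) ^+ 2.
  by apply: sumr_ge0 => z _; apply: sqr_ge0.
under [RHS]eq_bigr => z _ do rewrite expr2 big_distrlr /=.
rewrite [RHS](exchange_big_dep predT) //= mulr_sumr; apply: eq_bigr => u _.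
rewrite [RHS](exchange_big_dep predT) //= mulr_sumr; apply: eq_bigr => v _.
have memE z : ((z \notin T) && (z + u \in T)) && (z + v \in T) =
    ((u \notin T) && (v + u \in T)) && (z + u \in T).
  case: (boolP (z + u \in T)) => zuT; last by rewrite !andbF.
  have zE : z = (z + u) + u by rewrite -addrA addrr_F2 addr0.
  have -> : (z \in T) = (u \in T) by rewrite {1}zE subspaceDl.
  have -> : (z + v \in T) = (v + u \in T).
    by rewrite -(subspaceDl (v + u) subT zuT) (addrC v) addrA -zE.
  by rewrite !andbT.
rewrite (eq_bigl _ _ memE).
case: (boolP ((u \notin T) && (v + u \in T))) => uvT /=; last first.
  by rewrite big_pred0 // !mulr0.
rewrite (eq_bigl (mem [set u + x | x in T])) => [|z /=].
  rewrite sumr_const card_imset; last exact: can_inj (addKv u).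
  by rewrite mulr1 mulr_natl.
apply/idP/imsetP => [zuT|[x xT ->]]; last by rewrite addrC addKv.
by exists (z + u) => //; rewrite addrC -addrA addrr_F2 addr0.
Qed.

(** After expansion of the squares, [sum_codimK_notin2] gives the coefficient of [h u * h v], and
    the coset form appears. This is the source of convexity. *)
Lemma sum_codimK_sqr_ge0 T (h : W k -> R) : is_subspace T ->
  0 <= \sum_(S | proper_subspace S && (T \subset S))
         codimK S * (\sum_(v | v \notin S) h v) ^+ 2.
Proof.
move=> subT; have := coset_form_ge0 h subT; congr (0 <= _).
under [RHS]eq_bigr => S _ do
  rewrite expr2 !(big_mkcond (fun v => v \notin S)) big_distrlr mulr_sumr /=.
rewrite [RHS]exchange_big /=; apply: eq_bigr => u _.
under [RHS]eq_bigr => S _ do rewrite mulr_sumr.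
rewrite [RHS]exchange_big /=; apply: eq_bigr => v _.
rewrite -(sum_codimK_notin2 u v subT) mulr_sumr; apply: eq_bigr => S _.
by case: (u \in S); case: (v \in S); rewrite /= ?(mulr0, mul0r, mulr1) // mulrC.
Qed.

Definition span_set A : {set W k} := [set v | v \in <<enum A>>%VS].

Lemma subspace_span_set A : is_subspace (span_set A).
Proof.
by apply: subspace_intro => [|u v]; rewrite !inE ?mem0v //; apply: memvD.
Qed.

Lemma span_set_subset A S : is_subspace S ->
  (span_set A \subset S) = (A \subset S).
Proof.
move=> subS; apply/fintype.subsetP/fintype.subsetP => AS u uA.
  by apply: AS; rewrite inE memv_span ?mem_enum.
rewrite -mem_span_enum //; move: uA; rewrite inE; apply: subvP.
by apply: sub_span => v; rewrite !mem_enum; apply: AS.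
Qed.

(* Probability that the revealed set is exactly A when each v is revealed
   independently with probability 1 - exp (- y v). *)
Definition reveal_prob (y : W k -> R) A : R :=
  \prod_v (if v \in A then 1 - expR (- y v) else expR (- y v)).

Lemma reveal_prob_ge0 (y : W k -> R) A :
  (forall v, 0 <= y v) -> 0 <= reveal_prob y A.
Proof.
move=> y0; apply: prodr_ge0 => v _; case: ifP => _; rewrite ?expR_ge0 //.
by rewrite subr_ge0 -expR0 ler_expR oppr_le0.
Qed.

(** Both sides are the probability that no vector outside [S] is revealed. *)
Lemma expR_notin_sum (y : W k -> R) S :
  expR (- \sum_(v | v \notin S) y v) =
  \sum_(A : {set W k} | A \subset S) reveal_prob y A.
Proof.
rewrite -sumrN expR_sum big_mkcond /=.
(* Each factor lists the outcomes revealed and hidden; the 0 forbids revealing a vector outside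
   [S]. *)
transitivity (\prod_v ((if v \in S then 1 - expR (- y v) else 0) + expR (- y v))).
  by apply: eq_bigr => v _; case: (v \in S); rewrite /= ?subrK ?add0r.
rewrite bigA_distr /= [RHS]big_mkcond /=; apply: eq_big => // A _.
case: (boolP (A \subset S)) => [/fintype.subsetP AS|/fintype.subsetPn[v vA vS]].
  by apply: eq_bigr => v _; case: ifP => // /AS ->.
by rewrite (bigD1 v) //= vA (negPf vS) mul0r.
Qed.

(** The sum is the expected total of [c] over the proper subspaces containing the revealed set, and
    containing a set amounts to containing its span. *)
Lemma expR_weighted_sum_ge0 (c : {set W k} -> R) (y : W k -> R) :
  (forall v, 0 <= y v) ->
  (forall T, is_subspace T ->
     0 <= \sum_(S | proper_subspace S && (T \subset S)) c S) ->
  0 <= \sum_(S | proper_subspace S) c S * expR (- \sum_(v | v \notin S) y v).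
Proof.
move=> y0 c0.
under eq_bigr => S _ do rewrite expR_notin_sum mulr_sumr.
rewrite (exchange_big_dep predT) //=; apply: sumr_ge0 => A _.
rewrite -mulr_suml mulr_ge0 ?reveal_prob_ge0 //.
rewrite (eq_bigl (fun S => proper_subspace S && (span_set A \subset S))).
  by apply: c0; apply: subspace_span_set.
move=> S; case: (boolP (proper_subspace S)) => //= /andP[subS _].
by rewrite span_set_subset.
Qed.

(** If [lam] is linear with value 1 at [u] and [v], then [lam (u + v) = 0], so adding
    [lam w *: (u + v)] to [w] is an involution taking [u] to [v]. *)
Lemma transvection_exists u v : u != 0 -> v != 0 ->
  exists tau : W k -> W k,
    [/\ involutive tau, {morph tau : x y / x + y} & tau u = v].
Proof.
move=> u0 v0.
have F2P (a : 'F_2) : a != 0 -> a = 1.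
  by case: a => [[|[|//]] ?] // _; apply/val_inj.
have coord_neq0 (w : W k) : w != 0 -> exists i, w 0 i = 1.
  by case/rV0Pn => i wi; exists i; apply: F2P.
have [lam [lamD lamu lamv]] : exists lam : W k -> 'F_2,
    [/\ {morph lam : x y / x + y}, lam u = 1 & lam v = 1].
  have [i ui] := coord_neq0 u u0; have [j vj] := coord_neq0 v v0.
  have [vi|/F2P vi] := eqVneq (v 0 i) 0; last first.
    by exists (fun w => w 0 i); split=> // x y; rewrite mxE.
  have [uj|/F2P uj] := eqVneq (u 0 j) 0; last first.
    by exists (fun w => w 0 j); split=> // x y; rewrite mxE.
  (* Here [u] has coordinates 1 at [i] and 0 at [j], and [v] the reverse. *)
  exists (fun w => w 0 i + w 0 j); split=> [x y||].
  - by rewrite !mxE addrACA.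
  - by rewrite ui uj addr0.
  - by rewrite vi vj add0r.
have F2vv (a : 'F_2) : a + a = 0 by rewrite addrr_pchar2 ?pchar_Fp.
have lamZ a w : lam (a *: w) = a * lam w.
  have [->|/F2P ->] := eqVneq a 0; last by rewrite scale1r mul1r.
  by rewrite scale0r mul0r; have := lamD 0 0; rewrite addr0 F2vv.
exists (fun w => w + lam w *: (u + v)); split=> [w|x y|].
- by rewrite lamD lamZ lamD lamu lamv F2vv mulr0 addr0 -addrA addrr_F2 addr0.
- by rewrite lamD scalerDl addrACA.
- by rewrite lamu scale1r addKv.
Qed.

Lemma subspace_preim (tau : W k -> W k) S : {morph tau : x y / x + y} ->
  is_subspace S -> is_subspace (tau @^-1: S).
Proof.
move=> tauD subS; apply: subspace_intro => [|u v].
  by rewrite inE; have := tauD 0 0; rewrite addr0 => ->; rewrite addrr_F2 subspace0.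
by rewrite !inE tauD; apply: subspaceD.
Qed.

(** A transvection exchanging [u] and [v] permutes the proper subspaces and preserves their
    cardinality, the only thing [f] sees. *)
Lemma sum_notin_sym (f : nat -> R) u v : u != 0 -> v != 0 ->
  \sum_(S | proper_subspace S) f #|S| * (u \notin S)%:R =
  \sum_(S | proper_subspace S) f #|S| * (v \notin S)%:R.
Proof.
move=> u0 v0; have [tau [tauK tauD tauu]] := transvection_exists u0 v0.
have cardE S : #|tau @^-1: S| = #|S| by rewrite card_preimset //; apply: inv_inj.
have preK : involutive (fun S => tau @^-1: S).
  by move=> S; apply/setP => w; rewrite !inE tauK.
have psub S : proper_subspace S -> proper_subspace (tau @^-1: S).
  case/andP=> subS ST; rewrite /proper_subspace subspace_preim //=.
  by rewrite properEcard finset.subsetT /= cardE; apply: proper_card.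
rewrite (reindex_inj (inv_inj preK)) /=; apply: eq_big => [S|S _].
  by apply/idP/idP => [/psub|]; [rewrite preK | apply: psub].
by rewrite cardE inE tauu.
Qed.

End Codimension.

(** * Derivatives and convexity of sums of exponentials along a segment *)

Section ExponentialSums.

Import numFieldNormedType.Exports.

Variables (R : realType) (I : finType) (P : pred I).
Implicit Types (c a b : I -> R).

Lemma is_derive_sum_pred (F : I -> R -> R) (dF : I -> R) (x : R) :
  (forall i, is_derive x 1 (F i) (dF i)) ->
  is_derive x 1 (fun t => \sum_(i | P i) F i t) (\sum_(i | P i) dF i).
Proof.
move=> FdF; elim: (index_enum I) => [|i r IHr].
  rewrite big_nil (_ : (fun _ => _) = cst 0); first exact: is_derive_cst.
  by apply/funext => t; rewrite big_nil.
rewrite big_cons; case: ifP => Pi.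
  rewrite (_ : (fun _ => _) = F i + (fun t => \sum_(j <- r | P j) F j t)).
    exact: is_deriveD.
  by apply/funext => t; rewrite big_cons Pi.
rewrite (_ : (fun _ => _) = fun t => \sum_(j <- r | P j) F j t) //.
by apply/funext => t; rewrite big_cons Pi.
Qed.

Lemma is_derive_expR_sum c a b (x : R) :
  is_derive x 1 (fun t => \sum_(i | P i) c i * expR (a i + t * b i))
    (\sum_(i | P i) c i * b i * expR (a i + x * b i)).
Proof.
apply: is_derive_sum_pred => i.
have affine : is_derive x 1 (fun t : R => a i + t * b i) (b i).
  rewrite (_ : (fun _ => _) = cst (a i) + b i \*: id).
    have := is_deriveD (is_derive_cst (a i) x 1) (is_deriveZ (b i) (is_derive_id x 1)).
    by rewrite add0r [_ *: _]mulr1.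
  by apply/funext => t; rewrite fctE mulrC.
rewrite (_ : (fun _ => _) = c i \*: (expR \o (fun t : R => a i + t * b i))) //.
rewrite -mulrA [b i * _]mulrC.
by apply: is_deriveZ; apply: is_derive1_comp.
Qed.

Lemma derive_ge0_le (f df : R -> R) (x y : R) : x <= y ->
  (forall t : R, is_derive t 1 f (df t)) ->
  (forall t, x <= t <= y -> 0 <= df t) -> f x <= f y.
Proof.
move=> xy fdf df0.
have fcont : {within `[x, y], continuous f}%classic.
  by apply: derivable_within_continuous => z _; apply: ex_derive.
have [t] := MVT_segment xy (fun t _ => fdf t) fcont.
rewrite in_itv /= => txy fE.
by rewrite -subr_ge0 fE mulr_ge0 ?subr_ge0 // df0.
Qed.

(** As a function of [t] on [0, 1], the first derivative is nondecreasing and starts nonnegative.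
    The signs of [c] may vary, so the second derivative is controlled only as a whole sum. *)
Lemma expR_sum_le c a b :
  (forall t, 0 <= t <= 1 ->
     0 <= \sum_(i | P i) c i * b i * b i * expR (a i + t * b i)) ->
  0 <= \sum_(i | P i) c i * b i * expR (a i) ->
  \sum_(i | P i) c i * expR (a i) <= \sum_(i | P i) c i * expR (a i + b i).
Proof.
move=> d2 d1.
pose f c t := \sum_(i | P i) c i * expR (a i + t * b i).
have f0 c' : f c' 0 = \sum_(i | P i) c' i * expR (a i).
  by apply: eq_bigr => i _; rewrite mul0r addr0.
have f1 : f c 1 = \sum_(i | P i) c i * expR (a i + b i).
  by apply: eq_bigr => i _; rewrite mul1r.
rewrite -f0 -f1; apply: (@derive_ge0_le _ (f (fun i => c i * b i))) => //.
  by move=> t; apply: is_derive_expR_sum.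
move=> t /andP[t0 t1]; apply: (le_trans d1); rewrite -f0.
apply: (@derive_ge0_le _ (f (fun i => c i * b i * b i))) => //.
  by move=> s; apply: is_derive_expR_sum.
by move=> s /andP[s0 st]; apply: d2; rewrite s0 (le_trans st).
Qed.

End ExponentialSums.

(** * Global minimality of the uniform point *)

Section UniformMinimizer.

Variables (R : realType) (k : nat).
Implicit Types (S T : {set W k}) (u v : W k) (q : W k -> R).

(** For [a] equal to - n ln(eps), this is the subspace sum of the loss on the simplex, with
    coordinates indexed by vectors. *)
Definition erasure_sum (a : R) q : R :=
  \sum_(S | proper_subspace S)
     codimK R S * expR (- \sum_(v | v \notin S) a * q v).

Lemma erasure_sum_uniform_min (a c : R) q : 0 <= a -> 0 <= c ->
  (forall v, 0 <= q v) ->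
  \sum_v q v = \sum_(v : W k) (if v == 0 then 0 else c) ->
  erasure_sum a (fun v => if v == 0 then 0 else c) <= erasure_sum a q.
Proof.
move=> a0 c0 q0 sumq; set q' := fun v : W k => if v == 0 then 0 else c.
have q'0 v : 0 <= q' v by rewrite /q'; case: ifP.
pose h v := q v - q' v.
have expE t S : - (\sum_(v | v \notin S) a * q' v) +
    t * - (\sum_(v | v \notin S) a * h v) =
    - \sum_(v | v \notin S) a * (q' v + t * h v).
  rewrite mulrN mulr_sumr -opprD -big_split /=; congr (- _).
  by apply: eq_bigr => v _; ring.
have -> : erasure_sum a q = \sum_(S | proper_subspace S) codimK R S *
    expR (- (\sum_(v | v \notin S) a * q' v) + - (\sum_(v | v \notin S) a * h v)).
  apply: eq_bigr => S _; rewrite -[X in _ + X]mul1r expE; congr (_ * expR (- _)).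
  by apply: eq_bigr => v _; rewrite mul1r /h addrC subrK.
apply: expR_sum_le => [t /andP[t0 t1]|].
  (* Second derivative: the weights are [codimK] times squares, and the points of the segment keep
     nonnegative coordinates. *)
  under eq_bigr => S _ do rewrite expE -(mulrA (codimK R S)) mulrNN -expr2.
  apply: expR_weighted_sum_ge0 => [v|T subT]; last exact: sum_codimK_sqr_ge0.
  have -> : q' v + t * h v = (1 - t) * q' v + t * q v by rewrite /h; ring.
  by rewrite mulr_ge0 // addr_ge0 ?mulr_ge0 // subr_ge0.
(* The partial derivative at the uniform point in the coordinate [v] is [- a * G v]. *)
pose G v := \sum_(S | proper_subspace S) codimK R S *
   expR (- \sum_(v | v \notin S) a * q' v) * (v \notin S)%:R.
have GE : \sum_(S | proper_subspace S) codimK R S *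
    - (\sum_(v | v \notin S) a * h v) * expR (- \sum_(v | v \notin S) a * q' v) =
    - (a * \sum_v h v * G v).
  rewrite -mulrN -sumrN mulr_sumr.
  under eq_bigr => S _ do rewrite -sumrN big_mkcond /= mulr_sumr mulr_suml.
  rewrite exchange_big /=; apply: eq_bigr => v _.
  rewrite /G mulr_sumr -sumrN mulr_sumr; apply: eq_bigr => S _.
  by case: (v \in S) => /=; ring.
have G0 v : 0 <= G v.
  rewrite /G; under eq_bigr => S _ do rewrite mulrAC.
  apply: expR_weighted_sum_ge0 => [w|T subT]; first by rewrite mulr_ge0.
  by rewrite sum_codimK_notin.
have Gzero : G 0 = 0.
  rewrite /G big1 // => S /andP[subS _].
  by rewrite (subspace0 subS) mulr0.
have Gsym u v : u != 0 -> v != 0 -> G u = G v.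
  (* The vectors off [S] are nonzero and carry mass [c] each, so the weight of [S] depends on [#|S|]
     alone; [trunc_log] recovers the dimension. *)
  pose f m : R := Kc R (k - trunc_log 2 m) * expR (- ((2 ^ k - m)%:R * (a * c))).
  suff GfE w : G w = \sum_(S | proper_subspace S) f #|S| * (w \notin S)%:R.
    by rewrite !GfE; apply: sum_notin_sym.
  apply: eq_bigr => S /andP[subS _]; congr (_ * _ * _).
    by rewrite /codimK card_subspace // trunc_expnK.
  congr (expR (- _)); rewrite (eq_bigr (fun=> a * c)) => [|v' v'S].
    rewrite (eq_bigl (mem (~: S))) => [|w']; last by rewrite /= inE.
    by rewrite sumr_const cardsCs finset.setCK card_mx card_Fp // mul1n mulr_natl.
  rewrite /q'; case: eqP => // v'E; move: v'S.
  by rewrite v'E (subspace0 subS).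
rewrite GE -mulrN mulr_ge0 // oppr_ge0.
have sumh : \sum_v h v = 0 by rewrite sumrB sumq subrr.
case: (pickP (fun v : W k => v != 0)) => [u u0|all0].
  rewrite (bigD1 0) //= Gzero mulr0 add0r.
  rewrite (eq_bigr (fun v => h v * G u)) => [|v v0]; last by rewrite (Gsym v u).
  rewrite -mulr_suml; apply: mulr_le0_ge0 => //.
  (* The coordinates of [h] at nonzero vectors add up to [- h 0], that is [- q 0]. *)
  move: sumh; rewrite (bigD1 0) //= => /eqP; rewrite addrC addr_eq0 => /eqP ->.
  by rewrite oppr_le0 /h /q' eqxx subr0.
rewrite big1 // => v _; have /negbFE/eqP -> := all0 v.
by rewrite Gzero mulr0.
Qed.

End UniformMinimizer.

(** * From the indexed loss to a sum over proper subspaces *)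

Section VectorFractionCodes.

Variables (R : realType) (k : nat).

Lemma binary_digits_inj m n d : (m < 2 ^ d)%N -> (n < 2 ^ d)%N ->
  (forall j, (j < d)%N -> odd (m %/ 2 ^ j) = odd (n %/ 2 ^ j)) -> m = n.
Proof.
elim: d m n => [|d IHd] m n; first by rewrite expn0 !ltnS !leqn0 => /eqP-> /eqP->.
rewrite expnS => md nd mnE.
have := mnE 0%N isT; rewrite expn0 !divn1 => oddE.
have halfE : (m %/ 2 = n %/ 2)%N.
  apply: IHd => [||j jd]; rewrite ?ltn_divLR // 1?mulnC //.
  by rewrite -!divnMA -expnS mnE.
by rewrite (divn_eq m 2) (divn_eq n 2) halfE !modn2 oddE.
Qed.

Lemma nu_inj : injective (@nu k).
Proof.
move=> i j /rowP nuE; apply: val_inj; apply: (binary_digits_inj (ltn_ord i) (ltn_ord j)) => d dk.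
have := nuE (Ordinal dk); rewrite !mxE /=.
by case: odd; case: odd => // /eqP; rewrite ?[_ == 0]eq_sym.
Qed.

Lemma nu_bij : bijective (@nu k).
Proof.
apply: inj_card_bij; first exact: nu_inj.
by rewrite card_ord card_mx card_Fp // mul1n.
Qed.

Lemma nu_eq0 (i : 'I_(2 ^ k)) : (nu i == 0) = (val i == 0%N).
Proof.
have pos : (0 < 2 ^ k)%N by rewrite expn_gt0.
have nu0 : nu (Ordinal pos) = 0 by apply/rowP => j; rewrite !mxE /= div0n.
by rewrite -nu0 (inj_eq nu_inj).
Qed.

(** Proper subspaces are sorted by codimension [d]: [d >= 1] leaves out the whole space, and
    [d <= k] keeps the truncated subtraction exact. *)
Lemma sum_Xi (F : {set W k} -> R) :
  \sum_(1 <= d < k.+1) Kc R d * \sum_(S in Xi k (k - d)) F S =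
  \sum_(S | proper_subspace S) codimK R S * F S.
Proof.
rewrite big_nat.
under eq_bigr => d _ do rewrite mulr_sumr.
rewrite (exchange_big_dep (@proper_subspace k)) /=; last first.
  move=> d S /andP[d1 dk]; rewrite inE => /andP[subS /eqP dimS].
  rewrite /proper_subspace subS properEcard finset.subsetT.
  rewrite !card_subspace ?subspaceT // ltn_exp2l // sdimT /sdim dimS.
  by move: d1 dk; lia.
apply: eq_bigr => S /andP[subS ST].
have dimS := sdim_lt subS (subspaceT k) ST; rewrite sdimT in dimS.
rewrite big_mkcond (bigD1_seq (k - sdim S)%N) ?iota_uniq //=; last first.
  by rewrite mem_index_iota subn_gt0 dimS ltnS leq_subr.
rewrite subn_gt0 dimS ltnS leq_subr inE subS subKn ?(ltnW dimS) // eqxx /=.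
rewrite big1 ?addr0 // => d dneq; case: ifP => // /andP[/andP[d1 dk]].
rewrite inE => /andP[_ /eqP dimSE]; move: dneq; rewrite /sdim dimSE subKn //.
by rewrite eqxx.
Qed.

(** Total mass 1 makes [1 - zeta S q] the mass off [S], and [eps != 0] turns the real power into an
    exponential. *)
Lemma loss_erasure_sum (n : nat) (eps : R) (g : W k -> 'I_(2 ^ k))
    (q : 'I_(2 ^ k) -> R) :
  eps != 0 -> cancel (@nu k) g -> cancel g (@nu k) -> \sum_i q i = 1 ->
  loss n eps q = n%:R * (1 - eps) - k%:R +
    erasure_sum (- (n%:R * ln eps)) (fun v => q (g v)).
Proof.
move=> eps0 nuK gK sumq; rewrite /loss sum_Xi; congr (_ + _).
apply: eq_bigr => S _; rewrite /powR (negPf eps0); congr (_ * expR _).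
rewrite -mulr_sumr mulNr opprK mulrAC; congr (_ * _).
rewrite (reindex (@nu k)) /=; last by apply: onW_bij; exists g.
under [RHS]eq_bigr => i _ do rewrite nuK.
have := sumq; rewrite (bigID (fun i => nu i \in S)) /= => <-.
by rewrite /zeta addrAC subrr add0r.
Qed.

End VectorFractionCodes.

Theorem theorem3 (R : realType) (kappa n : nat) (eps : R) :
  (1 <= kappa)%N -> (1 <= n)%N -> 0 < eps < 1 ->
  local_minimizer (@simplexC R kappa) (@loss R kappa n eps) (@qbar R kappa).
Proof.
move=> kappa1 _ /andP[eps0 eps1].
have [g nuK gK] := nu_bij kappa.
have sum_g (q : 'I_(2 ^ kappa) -> R) : \sum_i q i = \sum_v q (g v).
  by rewrite (reindex g) //; apply: onW_bij; exists (@nu kappa).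
have c0 : 0 <= (2 ^+ kappa - 1 : R)^-1.
  by rewrite invr_ge0 subr_ge0 exprn_ege1 // ler1n.
have qbarE v : qbar R (g v) = if v == 0 then 0 else (2 ^+ kappa - 1)^-1.
  by rewrite /qbar -nu_eq0 gK.
have sumbar : \sum_(i < 2 ^ kappa) qbar R i = 1 :> R.
  rewrite sum_g; under eq_bigr => v _ do rewrite qbarE.
  rewrite (bigD1 0) //= eqxx add0r (eq_bigr (fun=> (2 ^+ kappa - 1)^-1)).
    rewrite (eq_bigl (mem [set~ (0 : W kappa)])) => [|v]; last by rewrite /= !inE.
    rewrite sumr_const cardsC1 card_mx card_Fp // mul1n -[LHS]mulr_natl.
    have -> : (2 ^ kappa).-1%:R = 2 ^+ kappa - 1 :> R.
      by rewrite -subn1 natrB ?expn_gt0 // natrX.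
    rewrite divff // subr_eq0.
    by rewrite gt_eqF // exprn_egt1 ?ltr1n // -lt0n.
  by move=> v /negPf ->.
split.
  by split=> // i; rewrite /qbar; case: ifP.
(* Any radius would do, since the inequality holds on the whole simplex. *)
exists 1; split=> // q [q0 sumq] _.
rewrite !(loss_erasure_sum n (lt0r_neq0 eps0) nuK gK) // lerD2l.
have -> : (fun v => qbar R (g v)) = fun v => if v == 0 then 0 else (2 ^+ kappa - 1)^-1.
  exact/funext.
apply: erasure_sum_uniform_min => //.
  by rewrite oppr_ge0 mulr_ge0_le0 // ln_le0 // ltW.
under [RHS]eq_bigr => v _ do rewrite -qbarE.
by rewrite -!sum_g sumq sumbar.
Qed.
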